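(* One has $$f'(16)\ \ge\ \frac{31}{216}\ >\ \frac17 .$$ Consequently, consider for a positive multiple $\delta$ of $8$ the assertion $(\ast)_\delta$: there is a constant $C=C(\delta)$ such that every connected graph $G$ of order $n$, minimum degree $\delta$ and chromatic number $\chi(G)\le 3$ satisfies $\operatorname{diam}(G)\le \frac{16}{7}\cdot\frac{n}{\delta}+C$. Then $(\ast)_{8}$ is true and $(\ast)_{16}$ is false; that is, $\delta=16$ is the smallest multiple of $8$ for which $(\ast)_\delta$ fails.
   Context: All graphs are finite and simple. For an integer $\delta\ge 4$, $f'(\delta)$ denotes the smallest rational number such that $\operatorname{diam}(G)\le f'(\delta)\,n+O(1)$ for all connected graphs $G$ of order $n$, minimum degree $\delta$ and chromatic number $\chi(G)\le 3$, where the $O(1)$ term is bounded by a constant depending only on $\delta$. The assertion $(\ast)_\delta$ is the case $r=2$ of a conjecture of Erdős, Pach, Pollack and Tuza for $K_{2r}$-free graphs and $\delta$ a multiple of $(r-1)(3r+2)$, restricted to graphs of chromatic number at most $3$. *)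

(* Defs.v *)
From mathcomp Require Import all_boot all_order all_algebra.

Set Implicit Arguments.
Unset Strict Implicit.
Unset Printing Implicit Defensive.

Import Order.TTheory GRing.Theory Num.Theory.

Record sgraph := SGraph {
  vertex :> finType;
  edge : rel vertex;
  edge_sym : symmetric edge;
  edge_irrefl : irreflexive edge }.

Section GraphParameters.

Variable G : sgraph.
Implicit Types x y : G.

Definition order_of : nat := #|G|.

Definition connected : Prop := 0 < #|G| /\ forall x y, connect (@edge G) x y.

Definition degree x : nat := #|[set y | edge x y]|.

(* The default value #|G| exceeds every degree, so it never affects the minimum
   when G has a vertex. *)
Definition min_degree : nat := \big[minn/#|G|]_(x : G) degree x.

Definition walk (x y : G) (k : nat) : bool :=
  [exists p : k.-tuple G, path (@edge G) x p && (last x p == y)].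

(* Least length of a walk from x to y. A shortest walk has fewer than #|G| edges,
   so the search range is large enough; unconnected pairs get the value #|G|. *)
Definition dist x y : nat := find (walk x y) (iota 0 #|G|).

Definition diam : nat := \max_(x : G) \max_(y : G) dist x y.

Definition colorable (k : nat) : bool :=
  [exists f : {ffun G -> 'I_k}, forall x, forall y, edge x y ==> (f x != f y)].

Lemma colorable_ex : exists k, colorable k.
Proof.
exists #|G|; apply/existsP; exists [ffun x => enum_rank x].
apply/forallP=> x; apply/forallP=> y; apply/implyP=> xy; rewrite !ffunE.
by apply: contraTneq xy => /enum_rank_inj ->; rewrite edge_irrefl.
Qed.

Definition chromatic_number : nat := ex_minn colorable_ex.

End GraphParameters.

Local Open Scope ring_scope.

Definition in_class (delta : nat) (G : sgraph) : Prop :=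
  [/\ connected G, min_degree G = delta & (chromatic_number G <= 3)%N].

Definition diam_slope (delta : nat) (c : rat) : Prop :=
  exists C : rat, forall G : sgraph, in_class delta G ->
    (diam G)%:R <= c * (order_of G)%:R + C.

(* f is f'(delta): the smallest rational c with diam G <= c * n + O(1) on the class. *)
Definition is_fprime (delta : nat) (f : rat) : Prop :=
  diam_slope delta f /\ forall c : rat, diam_slope delta c -> f <= c.

(* The Erdos-Pach-Pollack-Tuza bound for K_4-free graphs (r = 2), restricted to
   graphs of chromatic number at most 3. *)
Definition EPPT_3colorable (delta : nat) : Prop :=
  exists C : rat, forall G : sgraph, in_class delta G ->
    (diam G)%:R <= 16 / 7 * ((order_of G)%:R / delta%:R) + C.

(* Main.v *)
(** Split a 3-coloured graph into the distance layers of a vertex [x] and keep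
    only the colour counts of each layer. Minimum degree at least [delta]
    becomes a condition on three consecutive layers. Conversely, a sequence of
    colour counts satisfying this condition is realised by joining all
    differently coloured vertices of equal or consecutive layers. Counts may be
    truncated at [delta], so f'(delta) is the reciprocal of the minimum cycle
    mean of a finite weighted digraph; this is why it exists and is rational.

    A closed walk of length 31 and weight 216 bounds f'(16) from below. For
    [delta = 8], a potential on pairs of consecutive layers shows that a layer
    has at least 7/2 vertices on average, which is the bound 2/7 = 16/(7 * 8). *)

Require Import Defs.
From mathcomp Require Import all_boot all_order all_algebra zify ring lra.

Set Implicit Arguments.
Unset Strict Implicit.
Unset Printing Implicit Defensive.

Import Order.TTheory GRing.Theory Num.Theory.

(** * Minimum cycle means *)

Section MinimumMeanCycle.

Variables (S : finType) (e : rel S) (wt : S -> nat).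

(** The closing edge of the cycle is the last step of the segment, since its target [st (i + l)] is
    [st i]. *)
Lemma cycle_map_iota (st : nat -> S) i l :
  0 < l -> st (i + l) = st i ->
  (forall k, i <= k < i + l -> e (st k) (st k.+1)) ->
  cycle e [seq st k | k <- iota i l].
Proof.
case: l => // l _ eq_st e_st /=.
rewrite -eq_st addnS -addSn -map_rcons -cats1.
have -> : iota i.+1 l ++ [:: i.+1 + l] = iota i.+1 l.+1.
  by rewrite -(addn1 l) iotaD.
apply/(pathP (st i)) => k; rewrite size_map size_iota => lt_k.
rewrite (nth_map 0) ?size_iota // nth_iota //.
case: k lt_k => [|k] lt_k.
  by rewrite /= addn0 addSn -addnS eq_st; apply: e_st; lia.
rewrite -[nth _ _ k.+1]/(nth (st i) [seq st j | j <- iota i.+1 l.+1] k).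
rewrite (nth_map 0) ?size_iota; last by lia.
by rewrite nth_iota; [rewrite addnS; apply: e_st|]; lia.
Qed.

(* Among more than #|S| consecutive states two coincide; cutting out the closed
   walk between them costs at least the minimum cycle mean per step. *)
Lemma walk_weight_lower_bound L W :
  (forall c, size c <= #|S| -> 0 < size c -> cycle e c ->
     W * size c <= L * \sum_(x <- c) wt x) ->
  forall D (st : nat -> S), (forall i, i.+1 < D -> e (st i) (st i.+1)) ->
    W * D <= L * (\sum_(0 <= i < D) wt (st i)) + W * #|S|.
Proof.
move=> minc D; elim/ltn_ind: D => D IH st e_st.
(* A walk of at most [#|S|] states is absorbed by the additive term. *)
have [leDS|ltSD] := leqP D #|S|.
  by rewrite (leq_trans _ (leq_addl _ _)) ?leq_mul2l ?leDS ?orbT.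
have [i [j [lt_ij le_jS eq_ij]]] : exists i j, [/\ i < j, j <= #|S| & st i = st j].
  have /injectivePn[a [b ne_ab eq_ab]] :
      ~~ injectiveb (fun k : 'I_#|S|.+1 => st k).
    by apply/negP=> /injectiveP /leq_card; rewrite card_ord ltnn.
  have [lt|lt|eq] := ltngtP a b; last by rewrite (val_inj eq) eqxx in ne_ab.
    by exists a, b; split=> //; apply: ltn_ord b.
  by exists b, a; split=> //; apply: ltn_ord a.
have [l jE] : exists l, j = i + l by exists (j - i); lia.
rewrite {j}jE in lt_ij le_jS eq_ij.
have l_gt0 : 0 < l by lia.
have le_lS : l <= #|S| by lia.
have /minc : cycle e [seq st k | k <- iota i l].
  by apply: cycle_map_iota => // k lt_k; apply: e_st; lia.
rewrite size_map size_iota big_map => /(_ le_lS l_gt0) cycle_bound.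
pose st' k := if k < i then st k else st (k + l).
have rest_bound : W * (D - l) <=
    L * (\sum_(0 <= k < D - l) wt (st' k)) + W * #|S|.
  apply: IH => [|k lt_kD]; first by lia.
  rewrite /st'; have [lt|ge] := ltnP k i; last first.
    by rewrite ltnNge leqW //= addSn; apply: e_st; lia.
  have [lt'|ge'] := ltnP k.+1 i; first by apply: e_st; lia.
  (* At the seam [st k] is followed by [st (i + l)], which equals [st i]. *)
  have iE : i = k.+1 by lia.
  by rewrite -iE -eq_ij iE; apply: e_st; lia.
have sum_st : \sum_(0 <= k < D) wt (st k) =
    \sum_(k <- iota i l) wt (st k) + \sum_(0 <= k < D - l) wt (st' k).
  rewrite (big_cat_nat (n := i)) //=; last by lia.
  rewrite (big_cat_nat (m := i) (n := i + l)) //=; [|lia..].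
  rewrite [in RHS](big_cat_nat (n := i)) //=; last by lia.
  rewrite addnCA; congr (_ + (_ + _)).
  - by rewrite /index_iota addKn.
  - by apply: eq_big_nat => k /andP[_ lt]; rewrite /st' lt.
  rewrite big_addn; apply: eq_big_nat => k /andP[ge _].
  by rewrite /st' ltnNge ge.
by rewrite sum_st mulnDr; nia.
Qed.

(** Cycles of length at most [#|S|] are finitely many, so one of them has the least mean; [c0] shows
    that there is one at all. *)
Lemma min_mean_cycle (c0 : seq S) :
    0 < size c0 <= #|S| -> cycle e c0 ->
  exists c : seq S, [/\ 0 < size c, cycle e c &
    forall D (st : nat -> S), (forall i, i.+1 < D -> e (st i) (st i.+1)) ->
      (\sum_(x <- c) wt x) * D <=
      size c * (\sum_(0 <= i < D) wt (st i)) + (\sum_(x <- c) wt x) * #|S|].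
Proof.
move=> /andP[c0_gt0 le_c0] cyc_c0.
pose mean (c : #|S|.-bseq S) : rat :=
  ((\sum_(x <- c) wt x)%:R / (size c)%:R)%R.
pose P (c : #|S|.-bseq S) := (0 < size c) && cycle e c.
have Pc0 : P (Bseq le_c0) by rewrite /P c0_gt0.
case: (Order.TotalTheory.arg_minP mean Pc0) => c /andP[c_gt0 cyc_c] c_min.
exists c; split=> // D st; apply: walk_weight_lower_bound => d le_d d_gt0 cyc_d.
have := c_min (Bseq le_d); rewrite /P d_gt0 => /(_ cyc_d).
rewrite /mean /= ler_pdivrMr ?ltr0n // mulrAC ler_pdivlMr ?ltr0n //.
by rewrite -!natrM ler_nat mulnC [in X in _ <= X -> _]mulnC.
Qed.

End MinimumMeanCycle.

(** * Distance layers of a 3-coloured graph *)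

Definition other (L : 'I_3 -> nat) (c : 'I_3) : nat := \sum_(d | d != c) L d.

Definition total (L : 'I_3 -> nat) : nat := \sum_c L c.

Lemma other_total L c : other L c = total L - L c.
Proof. by rewrite /total (bigD1 c) //= addKn. Qed.

(** The three terms add up to the largest degree that a vertex of colour [c] in the middle layer [v]
    can have; absent colours impose nothing. *)
Definition dominated (delta : nat) (u v w : 'I_3 -> nat) : bool :=
  [forall c, (0 < v c) ==> (delta <= other u c + other v c + other w c)].

Definition linked (v w : 'I_3 -> nat) : bool :=
  [exists c, exists d, [&& c != d, 0 < v c & 0 < w d]].

Lemma linkedI (u v : 'I_3 -> nat) c d :
  c != d -> 0 < u c -> 0 < v d -> linked u v.
Proof.
by move=> ne uc vd; apply/existsP; exists c; apply/existsP; exists d; rewrite ne uc.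
Qed.

Lemma linked_total_gt0 v w : linked v w -> 0 < total v /\ 0 < total w.
Proof.
case/existsP=> c /existsP[d /and3P[_ vc wd]].
by split; rewrite lt0n sum_nat_eq0 negb_forall; apply/existsP;
  [exists c | exists d]; rewrite -lt0n.
Qed.

Section Distance.

Variable G : sgraph.
Implicit Types x y z : G.

Lemma walkP x y k :
  reflect (exists p : seq G, [/\ size p = k, path (@edge G) x p & last x p = y])
          (walk x y k).
Proof.
apply: (iffP existsP) => [[p /andP[xp /eqP <-]]|[p [sz xp xy]]].
  by exists p; rewrite size_tuple.
by exists (tcast sz (in_tuple p)); rewrite val_tcast xp xy eqxx.
Qed.

(** A smaller [k] would lie in the search range, and [find] would have stopped there. *)
Lemma dist_le x y k : walk x y k -> dist x y <= k.
Proof.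
move=> xyk; rewrite leqNgt; apply/negP=> lt_k.
have lt_kG : k < #|G|.
  by apply: leq_trans lt_k _; rewrite -[X in _ <= X](size_iota 0) find_size.
by have := before_find 0 lt_k; rewrite nth_iota // add0n xyk.
Qed.

Hypothesis G_conn : connected G.

Lemma walk_dist x y : walk x y (dist x y).
Proof.
have [_ /(_ x y)/connectP[p xp ->]] := G_conn.
case/shortenP: xp => q xq uniq_q _.
have lt_q : size q < #|G|.
  by rewrite -[size q < _]/(size (x :: q) <= _) -(card_uniqP uniq_q) max_card.
have has_walk : has (walk x (last x q)) (iota 0 #|G|).
  by apply/hasP; exists (size q); [rewrite mem_iota | apply/walkP; exists q].
have := nth_find 0 has_walk; rewrite nth_iota ?add0n //.
by have := has_walk; rewrite has_find size_iota.
Qed.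

Lemma distxx x : dist x x = 0.
Proof. by apply/eqP; rewrite -leqn0; apply/dist_le/walkP; exists [::]. Qed.

Lemma dist_edge x y z : edge y z -> dist x z <= (dist x y).+1.
Proof.
move=> yz; apply/dist_le/walkP; have /walkP[p [sz xp py]] := walk_dist x y.
by exists (rcons p z); rewrite size_rcons sz last_rcons rcons_path xp py.
Qed.

(** Some edge of a walk from [x] to [y] crosses from distance at most [i] to distance above [i], and
    an edge raises the distance by at most one. *)
Lemma exists_edge_between_levels x y i : i < dist x y ->
  exists z z', [/\ edge z z', dist x z = i & dist x z' = i.+1].
Proof.
have [_ /(_ x y)/connectP[p xp ->]] := G_conn => lt_i.
have [z [z' [zz' le_z gt_z']]] :
    exists z z', [/\ edge z z', dist x z <= i & i < dist x z'].
  move: xp lt_i; have : dist x x <= i by rewrite distxx.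
  (* The start of the walk is generalised, while distances are still measured from [x]. *)
  move: {2 3 5}x => z; elim: p z => [|z' p IH] z le_z /=.
    by rewrite ltnNge le_z.
  case/andP=> zz' z'p gt_last; have [gt_z'|le_z'] := ltnP i (dist x z').
    by exists z, z'.
  exact: IH gt_last.
by exists z, z'; have := dist_edge x zz'; split=> //; lia.
Qed.

Lemma diam_attained : exists x y, diam G = dist x y.
Proof.
have [G_gt0 _] := G_conn; rewrite /diam.
have [x ->] := bigop.eq_bigmax (fun x => \max_(y : G) dist x y) G_gt0.
by have [y ->] := bigop.eq_bigmax (dist x) G_gt0; exists x, y.
Qed.

End Distance.

Lemma dist_le_diam (G : sgraph) (x y : G) : dist x y <= diam G.
Proof.
apply: leq_trans (leq_bigmax (F := fun x => \max_(y : G) dist x y) x).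
exact: (leq_bigmax (F := dist x)).
Qed.

Lemma min_degreeP (G : sgraph) m :
  0 < #|G| -> reflect ((forall x : G, m <= degree x) /\ (exists x : G, degree x <= m))
                      (min_degree G == m).
Proof.
rewrite /min_degree => G_gt0; set mn := \big[minn/_]_x _.
have mn_le (y : G) : mn <= degree y.
  rewrite /mn; have := mem_index_enum y.
  elim: (index_enum G) => [|z s IH]; first by rewrite in_nil.
  rewrite inE big_cons geq_min.
  by case/predU1P=> [->|/IH->]; rewrite ?leqnn ?orbT.
have mn_att : exists y : G, degree y <= mn.
  have /card_gt0P[y _] := G_gt0.
  (* The empty minimum is the default [#|G|], which is at least the degree of any vertex [y]. *)
  rewrite /mn; elim: (index_enum G) => [|z s [y' le_y']].
    by exists y; rewrite big_nil max_card.
  rewrite big_cons; case: leqP => _; last by exists y'.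
  by exists z.
apply: (iffP eqP) => [<-|[ge_m [y le_y]]]; first by split.
have [y0 mn_y0] := mn_att.
by apply/eqP; rewrite eqn_leq (leq_trans (mn_le y)) // (leq_trans _ mn_y0).
Qed.

Section DistanceLayers.

Variables (G : sgraph) (f : G -> 'I_3).
Hypothesis G_conn : connected G.
Hypothesis f_col : forall x y, edge x y -> f x != f y.
Variable x : G.

Definition dist_layer (i : nat) (c : 'I_3) : nat :=
  #|[set z | (dist x z == i) && (f z == c)]|.

Lemma other_dist_layer i c :
  other (dist_layer i) c = #|[set z | (dist x z == i) && (f z != c)]|.
Proof.
rewrite /other -sum1_card (partition_big f (fun d => d != c)) /=; last first.
  by move=> z; rewrite inE => /andP[].
apply: eq_bigr => d ne_dc; rewrite /dist_layer -sum1_card; apply: eq_bigl => z.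
by rewrite !inE -andbA; case: eqP => //= _; case: eqP => [->|]; rewrite ?ne_dc ?andbF.
Qed.

Lemma total_dist_layer i : total (dist_layer i) = #|[set z | dist x z == i]|.
Proof.
rewrite /total -sum1_card (partition_big f predT) //=.
apply: eq_bigr => d _; rewrite /dist_layer -sum1_card; apply: eq_bigl => z.
by rewrite !inE.
Qed.

(** After exchanging the sums, each vertex is counted at most once, in the layer of its own
    distance. *)
Lemma sum_dist_layer n : \sum_(0 <= i < n) total (dist_layer i) <= #|G|.
Proof.
under eq_bigr => i _ do rewrite total_dist_layer -sum1_card big_mkcond /=.
rewrite exchange_big /= -sum1_card; apply: leq_sum => z _.
under eq_bigr => i _ do rewrite inE.
rewrite big_mkord; have [lt_n|ge_n] := ltnP (dist x z) n; last first.
  rewrite big1 // => i _; case: eqP => // zi; have := ltn_ord i; lia.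
rewrite (bigD1 (Ordinal lt_n)) //= eqxx big1 // => i.
by rewrite -val_eqE /= eq_sym => /negPf->.
Qed.

(** A neighbour of a vertex has another colour, and its distance from [x] differs by at most one. *)
Lemma dominated_dist_layer i :
  dominated (min_degree G) (dist_layer i) (dist_layer i.+1) (dist_layer i.+2).
Proof.
apply/forallP=> c; apply/implyP; rewrite card_gt0 => /set0Pn[z].
rewrite inE => /andP[/eqP dz /eqP fz].
have G_gt0 : 0 < #|G| by case: G_conn.
have /(min_degreeP _ G_gt0)[/(_ z) deg_z _] := eqxx (min_degree G).
apply: leq_trans deg_z _; rewrite !other_dist_layer /degree.
set A := [set _ | _]; set B := [set _ | _]; set C := [set _ | _]; set D := [set _ | _].
have /subset_leq_card : A \subset B :|: C :|: D.
  apply/subsetP=> y; rewrite !inE => zy.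
  have ne_f : f y != c by rewrite -fz eq_sym f_col.
  have := dist_edge G_conn x zy.
  have /(dist_edge G_conn x) : edge y z by rewrite edge_sym.
  rewrite dz ne_f !andbT; lia.
have [+ _] := leq_card_setU (B :|: C) D; have [+ _] := leq_card_setU B C.
lia.
Qed.

Lemma linked_dist_layer y i :
  i < dist x y -> linked (dist_layer i) (dist_layer i.+1).
Proof.
case/(exists_edge_between_levels G_conn)=> z [z' [zz' dz dz']].
apply/existsP; exists (f z); apply/existsP; exists (f z').
by rewrite f_col //= !card_gt0; apply/andP; split; apply/set0Pn;
  [exists z | exists z']; rewrite inE ?dz ?dz' !eqxx.
Qed.

End DistanceLayers.

Lemma chromatic_number_le3P (G : sgraph) :
  reflect (exists f : G -> 'I_3, forall x y, edge x y -> f x != f y)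
          (chromatic_number G <= 3).
Proof.
rewrite /chromatic_number; case: ex_minnP => k col_k k_min.
apply: (iffP idP) => [le_k3|[g g_col]].
  have /existsP[f /forallP f_col] := col_k.
  exists (fun x => widen_ord le_k3 (f x)) => x y xy.
  by have /forallP/(_ y)/implyP/(_ xy) := f_col x.
apply: k_min; apply/existsP; exists [ffun x => g x].
apply/forallP=> x; apply/forallP=> y; apply/implyP => /g_col.
by rewrite !ffunE.
Qed.

(** * Graphs with prescribed layers *)

Section LayeredGraph.

Variables (p : nat -> 'I_3 -> nat) (N : nat).

(** Levels 0 and [N.+1] will be empty, so that every occupied level has a level on both sides. *)
Definition slot : finType := ('I_N.+2 * 'I_3)%type.

Definition layered_vertex : finType := {s : slot & 'I_(p s.1 s.2)}.

Definition layered_edge (x y : layered_vertex) : bool :=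
  [&& (tag x).1 <= (tag y).1.+1, (tag y).1 <= (tag x).1.+1 &
      (tag x).2 != (tag y).2].

Lemma layered_edge_sym : symmetric layered_edge.
Proof. by move=> x y; rewrite /layered_edge andbCA eq_sym. Qed.

Lemma layered_edge_irrefl : irreflexive layered_edge.
Proof. by move=> x; rewrite /layered_edge eqxx !andbF. Qed.

Definition layered_graph : sgraph := SGraph layered_edge_sym layered_edge_irrefl.

Lemma card_layered_slots (Q : pred slot) :
  #|[set x : layered_graph | Q (tag x)]| = \sum_(s | Q s) p s.1 s.2.
Proof.
rewrite -sum1_card; under eq_bigl => x do rewrite inE -[Q _]andbT.
rewrite -(sig_big_dep _ (fun s _ => true) (fun _ _ => 1)) /=.
by apply: eq_bigr => s _; rewrite sum1_card card_ord.
Qed.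

Lemma order_layered_graph :
  order_of layered_graph = \sum_(0 <= i < N.+2) total (p i).
Proof.
rewrite /order_of -cardsT; have := card_layered_slots xpredT.
rewrite /total big_mkord pair_big /= => <-.
by congr #|pred_of_set _|; apply/setP=> x; rewrite !inE.
Qed.

Hypothesis p0 : p 0 =1 fun=> 0.
Hypothesis pN : p N.+1 =1 fun=> 0.

Lemma level_bounds (x : layered_graph) :
  exists2 i : nat, (tag x).1 = i.+1 :> nat & i < N.
Proof.
case: x => [[[i lt_i] c] /= [k]]; case: i lt_i => [|i] lt_i /=; first by rewrite p0.
move=> lt_k; exists i => //; have [//|lt|eq] := ltngtP i N; first by lia.
by move: lt_k; rewrite eq pN.
Qed.

(** Adjacency depends only on level and colour. The range of levels is cut at [i] and [i.+3], and
    the outer parts contribute nothing. *)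
Lemma degree_layered_graph (x : layered_graph) i :
    (tag x).1 = i.+1 :> nat ->
  degree x = other (p i) (tag x).2 + other (p i.+1) (tag x).2
             + other (p i.+2) (tag x).2.
Proof.
move=> xi; set c := (tag x).2.
have lt_i : i < N by have [j] := level_bounds x; rewrite xi => -[->].
pose near (j : nat) := (i <= j) && (j <= i.+2).
transitivity (\sum_(j < N.+2 | near j) other (p j) c).
  rewrite pair_big_dep /= -card_layered_slots; congr #|pred_of_set _|.
  apply/setP=> y; rewrite !inE /= /layered_edge /near xi -/c andbA eq_sym.
  by rewrite ltnS [(i <= _) && _]andbC [(_ <= i.+2) && _]andbC.
rewrite -(big_mkord near (fun j => other (p j) c)).
rewrite (big_cat_nat (n := i)) //=; last by lia.
rewrite [X in _ + X](big_cat_nat (n := i.+3)) //=; [|lia..].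
rewrite big_nat_cond big_pred0 ?add0n; last by move=> j; rewrite /near; lia.
rewrite [X in _ + X]big_nat_cond [X in _ + X]big_pred0 ?addn0; last first.
  by move=> j; rewrite /near; lia.
rewrite big_nat_cond (eq_bigl (fun j => i <= j < i.+3)) -?big_nat; last first.
  by move=> j; rewrite /near; lia.
rewrite big_ltn; last by lia.
rewrite big_ltn; last by lia.
by rewrite big_nat1 addnA.
Qed.

Hypothesis p_linked : forall i, i.+1 < N -> linked (p i.+1) (p i.+2).
Hypothesis N_gt1 : 1 < N.

Lemma exists_vertex i c : i < N.+2 -> 0 < p i c ->
  exists2 x : layered_graph, (tag x).1 = i :> nat & (tag x).2 = c.
Proof.
move=> lt_i p_gt0.
pose s : slot := (Ordinal lt_i, c).
by exists (Tagged (fun s : slot => 'I_(p s.1 s.2)) (Ordinal p_gt0 : 'I_(p s.1 s.2))).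
Qed.

(* Two linked layers induce a complete multipartite graph with at least two
   parts. *)
Lemma connect_adjacent_levels i (x y : layered_graph) :
    i.+1 < N -> i < (tag x).1 <= i.+2 -> i < (tag y).1 <= i.+2 ->
  connect (@edge layered_graph) x y.
Proof.
move=> lt_i; have /existsP[c /existsP[d /and3P[ne_cd pc pd]]] := p_linked lt_i.
have [|a ai ac] := exists_vertex _ pc; first by lia.
have [|b bi bd] := exists_vertex _ pd; first by lia.
(* A vertex of a colour other than [c] is adjacent to [a]; one of colour [c] reaches [a] through
   [b]. *)
have connect_a (z : layered_graph) :
    i < (tag z).1 <= i.+2 -> connect (@edge layered_graph) z a.
  move=> zi; have [zc|ne_zc] := eqVneq (tag z).2 c.
    apply: (connect_trans (y := b)); apply: connect1; rewrite /= /layered_edge.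
      by rewrite bi bd zc ne_cd andbT; lia.
    by rewrite ai bi ac bd eq_sym ne_cd andbT; lia.
  by apply: connect1; rewrite /= /layered_edge ai ac ne_zc andbT; lia.
move=> /connect_a xa /connect_a ya; apply: connect_trans xa _.
by rewrite (sym_connect_sym (@edge_sym layered_graph)).
Qed.

(** A level is occupied because it is linked to the next one, and the last level because the
    previous one is linked to it. *)
Lemma exists_vertex_at_level i : i < N ->
  exists x : layered_graph, (tag x).1 = i.+1 :> nat.
Proof.
move=> lt_i; have [lt_Si|ge_Si] := ltnP i.+1 N.
  have /existsP[c /existsP[d /and3P[_ pc _]]] := p_linked lt_Si.
  by have [|x xi _] := exists_vertex _ pc; [lia | exists x].
case: i lt_i ge_Si => [|i] lt_i ge_i; first by lia.
have /existsP[c /existsP[d /and3P[_ _ pd]]] := p_linked lt_i.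
by have [|x xi _] := exists_vertex _ pd; [lia | exists x].
Qed.

Lemma connected_layered_graph : connected layered_graph.
Proof.
have [r r1] := exists_vertex_at_level (ltnW N_gt1).
split=> [|x y]; first by apply/card_gt0P; exists r.
have connect_r j (z : layered_graph) :
    (tag z).1 = j.+1 :> nat -> connect (@edge layered_graph) r z.
  elim: j z => [|j IH] z zj.
    by apply: (@connect_adjacent_levels 0) => //; rewrite ?r1 ?zj.
  have [j' ] := level_bounds z; rewrite zj => -[<-] lt_j.
  have [t tj] := exists_vertex_at_level (ltnW lt_j).
  apply: connect_trans (IH _ tj) _.
  by apply: (@connect_adjacent_levels j) => //; rewrite ?tj ?zj !leqnn ?andbT //=.
have [i /connect_r rx _] := level_bounds x.
have [j /connect_r ry _] := level_bounds y.
apply: connect_trans ry.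
by rewrite (sym_connect_sym (@edge_sym layered_graph)).
Qed.

(** Each edge of a walk raises the level by at most one. *)
Lemma dist_layered_graph (x y : layered_graph) :
  (tag y).1 <= (tag x).1 + dist x y.
Proof.
have /walkP[s [<- xs <-]] := walk_dist connected_layered_graph x y.
elim: s x xs => [|z s IH] x /=; first by rewrite addn0.
case/andP=> /and3P[_ le_zx _] zs; apply: leq_trans (IH z zs) _.
by rewrite addnS -addSn leq_add2r.
Qed.

Lemma chromatic_number_layered_graph : chromatic_number layered_graph <= 3.
Proof.
apply/chromatic_number_le3P; exists (fun x => (tag x).2) => x y.
by case/and3P.
Qed.

Lemma diam_layered_graph : N.-1 <= diam layered_graph.
Proof.
have [x x1] := exists_vertex_at_level (ltnW N_gt1).
have [|y yN] := @exists_vertex_at_level N.-1; first by lia.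
apply: leq_trans (dist_le_diam x y).
by have := dist_layered_graph x y; rewrite x1 yN; lia.
Qed.

End LayeredGraph.

(** * Lower bounds on the slope from periodic layer sequences *)

Lemma exists_other_color (c : 'I_3) : exists d, d != c.
Proof. by case: (eqVneq ord0 c) => [<-|]; [exists ord_max | exists ord0]. Qed.

(** A layer with [delta] vertices in every colour offers every vertex [delta] vertices of some other
    colour. *)
Lemma dominated_full delta u v w :
    [\/ forall c, delta <= u c, forall c, delta <= v c | forall c, delta <= w c] ->
  dominated delta u v w.
Proof.
have other_ge L c : (forall c', delta <= L c') -> delta <= other L c.
  move=> L_ge; have [d ne_dc] := exists_other_color c.
  by rewrite /other (bigD1 d) //= (leq_trans (L_ge d)) ?leq_addr.
move=> full; apply/forallP=> c; apply/implyP=> _.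
by case: full => /(other_ge _ c) ?; lia.
Qed.

Lemma linked_full (u v : 'I_3 -> nat) :
    [\/ (forall c, 0 < u c) /\ 0 < total v | (forall c, 0 < v c) /\ 0 < total u] ->
  linked u v.
Proof.
have totalP (L : 'I_3 -> nat) : 0 < total L -> exists c, 0 < L c.
  by rewrite lt0n sum_nat_eq0 negb_forall => /existsP[c]; rewrite -lt0n; exists c.
case=> -[full /totalP[c Lc]]; have [d ne_dc] := exists_other_color c.
  exact: linkedI ne_dc (full d) Lc.
by apply: linkedI Lc (full d); rewrite eq_sym.
Qed.

Section PeriodicLayers.

Variables (delta : nat) (w : nat -> 'I_3 -> nat).
Hypothesis delta_gt0 : 0 < delta.
Hypothesis w_dom : forall i, dominated delta (w i) (w i.+1) (w i.+2).
Hypothesis w_linked : forall i, linked (w i) (w i.+1).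

(* The layers of size [delta] in every colour give the ends of the segment
   enough neighbours; layers 1 and 2 supply a vertex of degree exactly [delta].
   Layers 0 and [n + 5] are empty. *)
Definition capped (n i : nat) : 'I_3 -> nat :=
  match i with
  | 0 => fun=> 0
  | 1 => fun c => c == ord0
  | 2 => fun c => if c == ord_max then delta else 0
  | 3 => fun=> delta
  | j.+4 => if j < n then w j else if j == n then fun=> delta else fun=> 0
  end.

Lemma capped_dominated n i : i < n.+4 ->
  dominated delta (capped n i) (capped n i.+1) (capped n i.+2).
Proof.
case: i => [|[|[|[|j]]]] lt_i.
(* Layer 1 is served by layer 2; in the next three cases the full layer 3 is the third, second and
   first of the triple. *)
- apply/forallP=> c; apply/implyP=> /=; rewrite lt0b => /eqP->.
  rewrite [X in _ + X]/other (bigD1 ord_max) //=; lia.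
- by apply: dominated_full; apply: Or33 => c /=.
- by apply: dominated_full; apply: Or32 => c /=.
- by apply: dominated_full; apply: Or31 => c /=.
have lt_jn : j < n by [].
rewrite /= lt_jn; have [lt_Sj|ge_Sj] := ltnP j.+1 n; last first.
  have -> : j.+1 = n by lia.
  by rewrite eqxx; apply: dominated_full; apply: Or32.
have [lt_SSj|ge_SSj] := ltnP j.+2 n; first exact: w_dom.
have -> : j.+2 = n by lia.
by rewrite eqxx; apply: dominated_full; apply: Or33.
Qed.

Lemma capped_linked n i : i.+1 < n.+4 -> linked (capped n i.+1) (capped n i.+2).
Proof.
have total_full : 0 < total (fun=> delta).
  by rewrite /total sum_nat_const card_ord muln_gt0.
case: i => [|[|[|j]]] lt_i.
- by apply: (@linkedI _ _ ord0 ord_max) => //=.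
- by apply: (@linkedI _ _ ord_max ord0) => //=.
- rewrite /=; apply: linked_full; left; split=> //.
  have [_|ge_n] := ltnP 0 n; first by have [] := linked_total_gt0 (w_linked 0).
  by have -> : n = 0 by lia.
have lt_jn : j < n by [].
rewrite /= lt_jn; have [lt_Sj|ge_Sj] := ltnP j.+1 n; first exact: w_linked.
have -> : j.+1 = n by lia.
rewrite eqxx; apply: linked_full; right; split=> //.
by have [] := linked_total_gt0 (w_linked j).
Qed.

Lemma capped_last n : capped n n.+4.+1 =1 fun=> 0.
Proof. by move=> c /=; rewrite ltnNge leqnSn /= (gtn_eqF (ltnSn n)). Qed.

Definition capped_graph n := layered_graph (capped n) n.+4.

Lemma in_class_capped_graph n : in_class delta (capped_graph n).
Proof.
have pN := @capped_last n.
have conn : connected (capped_graph n).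
  exact: connected_layered_graph (@capped_linked n) _.
split=> //; last exact: chromatic_number_layered_graph.
apply/eqP/min_degreeP; first by case: conn.
split=> [x|].
  have [i xi lt_i] := level_bounds (frefl _) pN x.
  rewrite (degree_layered_graph (frefl _) pN xi).
  have : 0 < capped n (tag x).1 (tag x).2.
    by case: (x) => [[k c] [m lt_m]] /=; apply: leq_ltn_trans lt_m.
  rewrite xi; have /forallP/(_ (tag x).2)/implyP := capped_dominated lt_i.
  exact.
(* The vertex of layer 1 has no neighbours in layers 0 and 1, hence only the [delta] vertices of
   layer 2. *)
have [//|/=|x x1 x0] := @exists_vertex (capped n) n.+4 1 ord0; first by [].
exists x; rewrite (degree_layered_graph (frefl _) pN x1) x0 /=.
rewrite /other big1 // add0n big1 ?add0n; last by move=> c /negPf->.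
by rewrite /other (bigD1 ord_max) //= big1 ?addn0 // => c /andP[_ /negPf->].
Qed.

(** Layer 1 has one vertex, layer 2 has [delta], and each of the two full layers has [3 * delta]. *)
Lemma order_capped_graph n :
  order_of (capped_graph n) = (7 * delta).+1 + \sum_(0 <= i < n) total (w i).
Proof.
rewrite order_layered_graph; do 4![rewrite big_ltn //].
rewrite big_nat_recr // big_nat_recr //=.
have total_const k : total (fun=> k) = 3 * k.
  by rewrite /total sum_nat_const card_ord.
rewrite !ltnn ltnNge leqnSn /= eqxx (gtn_eqF (ltnSn n)) !total_const.
have -> : total (fun c : 'I_3 => c == ord0) = 1.
  by rewrite /total (bigD1 ord0) //= big1 // => c /negPf->.
have -> : total (fun c : 'I_3 => if c == ord_max then delta else 0) = delta.
  by rewrite /total (bigD1 ord_max) //= big1 ?addn0 // => c /negPf->.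
rewrite -[n.+4]addn4 -[X in \sum_(X <= i < _) _]add0n big_addn addnK.
have -> : \sum_(0 <= i < n) total (capped n (i + 4)) = \sum_(0 <= i < n) total (w i).
  by apply: eq_big_nat => i /andP[_ lt_i]; rewrite addn4 /= lt_i.
by lia.
Qed.

Variable L : nat.
Hypothesis w_periodic : forall i, w (i + L) = w i.

Lemma sum_periodic k :
  \sum_(0 <= i < k * L) total (w i) = k * \sum_(0 <= i < L) total (w i).
Proof.
elim: k => [|k IH]; first by rewrite big_geq.
rewrite mulSn (big_cat_nat (n := L)) ?leq_addr //= mulSn -IH.
have := big_addn 0 (L + k * L) L xpredT (fun i => total (w i)).
rewrite add0n addKn => ->; congr (_ + _).
by apply: eq_bigr => i _; rewrite w_periodic.
Qed.

(** With [k] periods the diameter is at least [k * L] and the order is [k * W] plus a constant, so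
    [k * (L - c * W)] stays bounded as [k] grows. *)
Lemma slope_ge_periodic c :
  diam_slope delta c -> (L%:R <= c * (\sum_(0 <= i < L) total (w i))%:R)%R.
Proof.
set W := \sum_(_ <= _ < _) _; case=> C slopeC.
have segment k : (k%:R * (L%:R - c * W%:R) <= c * (7 * delta).+1%:R + C)%R.
  have := slopeC _ (in_class_capped_graph (k * L)).
  rewrite order_capped_graph sum_periodic -/W => bound.
  have : ((k * L)%:R <= (diam (capped_graph (k * L)))%:R :> rat)%R.
    have := diam_layered_graph (frefl _) (@capped_last _) (@capped_linked _) isT.
    by move=> /(_ (k * L)); rewrite ler_nat; apply: leq_trans; lia.
  rewrite natrD !natrM in bound *; lra.
rewrite leNgt; apply/negP=> lt_L.
set t := (L%:R - c * W%:R)%R in segment; set B := (_ + C)%R in segment.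
have t_gt0 : (0 < t)%R by rewrite subr_gt0.
(* If [t] were positive, some [k] above [B / t] would violate [segment]. *)
have := archi_boundP (normr_ge0 (B / t)%R); set k := Num.bound _ => lt_k.
have := segment k; rewrite leNgt => /negP; apply.
rewrite -ltr_pdivrMr //; apply: le_lt_trans lt_k; exact: ler_norm.
Qed.

End PeriodicLayers.

(** * Existence of f' *)

(** Unrolls a cycle into an infinite periodic walk; the step after the last entry is the closing
    edge. *)
Lemma cycle_nth_mod (T : Type) (e : rel T) x0 (c : seq T) i :
    0 < size c -> cycle e c ->
  e (nth x0 c (i %% size c)) (nth x0 c (i.+1 %% size c)).
Proof.
case: c => // x p _ /= /(pathP x0); rewrite size_rcons => step.
have lt_j : i %% (size p).+1 < (size p).+1 by rewrite ltn_pmod.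
have := step _ lt_j; rewrite -rcons_cons !nth_rcons /= lt_j.
set j := i %% _ in lt_j *.
have -> : i.+1 %% (size p).+1 = j.+1 %% (size p).+1 by rewrite -addn1 -modnDml addn1.
have [lt_jp|ge_jp] := ltnP j (size p); first by rewrite modn_small.
by have -> : j = size p by [lia]; rewrite eqxx modnn.
Qed.

Section OptimalSlope.

Variable delta : nat.
Hypothesis delta_gt0 : 0 < delta.

Definition layer : finType := {ffun 'I_3 -> 'I_delta.+1}.
Definition counts (t : layer) : 'I_3 -> nat := fun c => t c.
(** Two overlapping pairs of consecutive layers display the three layers that [dominated]
    compares. *)
Definition state : finType := (layer * layer)%type.

Definition step (s s' : state) : bool :=
  [&& s.2 == s'.1, linked (counts s.1) (counts s.2), linked (counts s'.1) (counts s'.2)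
    & dominated delta (counts s.1) (counts s.2) (counts s'.2)].

Definition truncate (L : 'I_3 -> nat) : layer := [ffun c => inord (minn delta (L c))].

Lemma counts_truncate L c : counts (truncate L) c = minn delta (L c).
Proof. by rewrite /counts ffunE inordK // ltnS geq_minl. Qed.

Lemma linked_truncate u v :
  linked u v -> linked (counts (truncate u)) (counts (truncate v)).
Proof.
case/existsP=> c /existsP[d /and3P[ne_cd uc vd]].
by apply: (linkedI ne_cd); rewrite counts_truncate leq_min delta_gt0.
Qed.

(** Either another colour reaches [delta] and suffices alone after truncation, or truncation leaves
    all other colours unchanged. *)
Lemma other_truncate L c : minn delta (other L c) <= other (counts (truncate L)) c.
Proof.
have [/existsP[d /andP[ne_dc ge_d]]|/existsPn small] :=
    boolP [exists d, (d != c) && (delta <= L d)].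
  rewrite [X in _ <= X]/other (bigD1 d) //= counts_truncate.
  by rewrite (minn_idPl ge_d) (leq_trans (geq_minl _ _)) ?leq_addr.
rewrite (leq_trans (geq_minr _ _)) // leq_sum // => d ne_dc.
rewrite counts_truncate leq_min leqnn andbT ltnW // ltnNge.
by have := small d; rewrite ne_dc.
Qed.

Lemma dominated_truncate u v w : dominated delta u v w ->
  dominated delta (counts (truncate u)) (counts (truncate v)) (counts (truncate w)).
Proof.
move=> /forallP dom; apply/forallP=> c; apply/implyP.
rewrite counts_truncate leq_min => /andP[_ vc].
have := implyP (dom c) vc.
have := other_truncate u c; have := other_truncate v c; have := other_truncate w c.
lia.
Qed.

Lemma total_truncate L : total (counts (truncate L)) <= total L.
Proof. by apply: leq_sum => c _; rewrite counts_truncate geq_minr. Qed.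

(** The value is length over weight of a cycle of least mean weight. Truncated distance layers form
    a walk, which gives the upper bound; unrolling the cycle shows that no smaller slope works. *)
Lemma fprime_exists : exists f, is_fprime delta f.
Proof.
(* The state of two full layers has a loop, so the digraph contains a cycle. *)
pose full : layer := [ffun=> ord_max].
have full_pos c : 0 < counts full c by rewrite /counts ffunE.
have cyc_full : cycle step [:: (full, full)].
  rewrite /= /step eqxx andbT /=; apply/and3P.
  have link : linked (counts full) (counts full).
    by apply: (@linkedI _ _ ord0 ord_max).
  split=> //; apply: dominated_full; apply: Or31 => c.
  by rewrite /counts ffunE.
have card_state : 0 < 1 <= #|state| by apply/card_gt0P; exists (full, full).
pose wt (s : state) := total (counts s.1).
have [c [c_gt0 cyc_c bound]] :=
  @min_mean_cycle _ step wt [:: (full, full)] card_state cyc_full.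
set W := \sum_(s <- c) wt s in bound.
pose w i := counts (nth (full, full) c (i %% size c)).1.
have step_c i := cycle_nth_mod (full, full) i c_gt0 cyc_c.
have w_linked i : linked (w i) (w i.+1).
  by have /and4P[/eqP eq_i lk _ _] := step_c i; rewrite /w -eq_i.
have w_dom i : dominated delta (w i) (w i.+1) (w i.+2).
  have /and4P[/eqP eq_i _ _ dom] := step_c i.
  have /and4P[/eqP eq_Si _ _ _] := step_c i.+1.
  by rewrite /w -eq_Si -eq_i.
have WE : W = \sum_(0 <= i < size c) total (w i).
  rewrite /W (big_nth (full, full)); apply: eq_big_nat => i /andP[_ lt_i].
  by rewrite /w modn_small.
have W_gt0 : 0 < W.
  rewrite WE big_ltn // ltn_addr //.
  by have [] := linked_total_gt0 (w_linked 0).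
exists ((size c)%:R / W%:R)%R; split=> [|c' slope_c'].
  (* The additive term [W * #|state|] of the walk bound, divided by [W]. *)
  exists #|state|%:R%R => G [conn degG /chromatic_number_le3P[f f_col]].
  have [x [y ->]] := diam_attained conn.
  pose t i := truncate (dist_layer f x i).
  have := bound (dist x y) (fun i => (t i, t i.+1)).
  have steps i : i.+1 < dist x y -> step (t i, t i.+1) (t i.+1, t i.+2).
    move=> lt_i; apply/and4P; split=> //=.
    - by apply: linked_truncate; apply: (linked_dist_layer conn f_col (ltnW lt_i)).
    - by apply: linked_truncate; apply: (linked_dist_layer conn f_col lt_i).
    - by apply: dominated_truncate; rewrite -degG; apply: dominated_dist_layer.
  move=> /(_ steps) {}bound.
  have bound' : W * dist x y <= size c * order_of G + W * #|state|.
    apply: leq_trans bound _; rewrite leq_add2r leq_mul2l; apply/orP; right.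
    apply: leq_trans (sum_dist_layer f x (dist x y)).
    by apply: leq_sum => i _; apply: total_truncate.
  rewrite mulrAC.
  have W_pos : (0 < W%:R :> rat)%R by rewrite ltr0n.
  rewrite -(ler_pM2l W_pos) mulrDr mulrCA mulfV ?gt_eqF // mulr1.
  by rewrite -!natrM -natrD ler_nat.
rewrite ler_pdivrMr ?ltr0n // WE.
by apply: slope_ge_periodic slope_c' => // i; rewrite /w modnDr.
Qed.

End OptimalSlope.

(** * Minimum degree 16 *)

(* A closed sequence of 31 layers, found by a shortest-cycle search, with 216
   vertices in total. *)
Definition cycle31 : seq (seq nat) :=
  [:: [:: 0; 0; 7]; [:: 7; 7; 0]; [:: 0; 0; 2]; [:: 0; 2; 0]; [:: 7; 0; 7];
      [:: 0; 7; 0]; [:: 0; 0; 2]; [:: 7; 2; 0]; [:: 0; 5; 7]; [:: 2; 0; 0];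
      [:: 0; 0; 4]; [:: 7; 7; 0]; [:: 0; 0; 5]; [:: 0; 2; 0]; [:: 4; 0; 7];
      [:: 3; 7; 0]; [:: 0; 0; 2]; [:: 0; 6; 0]; [:: 7; 0; 7]; [:: 0; 3; 0];
      [:: 0; 0; 2]; [:: 5; 8; 0]; [:: 2; 0; 7]; [:: 0; 1; 0]; [:: 7; 0; 0];
      [:: 0; 8; 7]; [:: 2; 0; 0]; [:: 0; 0; 1]; [:: 7; 7; 0]; [:: 0; 0; 8];
      [:: 1; 1; 0]].

Definition layer31 (i : nat) (c : 'I_3) : nat := nth 0 (nth [::] cycle31 (i %% 31)) c.

Lemma total_layer31 i : total (layer31 i) = sumn (nth [::] cycle31 (i %% 31)).
Proof.
have lt_i : i %% 31 < size cycle31 by rewrite ltn_pmod.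
have size3 : size (nth [::] cycle31 (i %% 31)) = 3.
  have /allP sizes : all (fun r => size r == 3) cycle31 by [].
  exact/eqP/sizes/mem_nth.
by rewrite sumnE (big_nth 0) size3 big_mkord.
Qed.

(** The condition depends only on [i %% 31]. It is restated as [ok] on rows of numbers, where
    evaluation decides it. *)
Lemma dominated_layer31 i : dominated 16 (layer31 i) (layer31 i.+1) (layer31 i.+2).
Proof.
pose row j := nth [::] cycle31 (j %% 31).
pose ok j c := (0 < nth 0 (row j.+1) c) ==>
  (16 <= (sumn (row j) - nth 0 (row j) c) + (sumn (row j.+1) - nth 0 (row j.+1) c)
         + (sumn (row j.+2) - nth 0 (row j.+2) c)).
have ok_all : all (fun j => all (ok j) (iota 0 3)) (iota 0 31) by vm_compute.
have eq_row k : row (i %% 31 + k) = row (i + k) by rewrite /row modnDml.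
have in_i : i %% 31 \in iota 0 31 by rewrite mem_iota ltn_pmod.
apply/forallP=> c; rewrite !other_total !total_layer31.
have /allP/(_ _ in_i)/allP/(_ c) := ok_all; rewrite mem_iota /= ltn_ord => /(_ isT).
have := eq_row 0; have := eq_row 1; have := eq_row 2.
by rewrite /ok !addn0 !addn1 !addn2 => -> -> ->.
Qed.

Lemma linked_layer31 i : linked (layer31 i) (layer31 i.+1).
Proof.
pose row j := nth [::] cycle31 (j %% 31).
pose ok j := has (fun c => has (fun d =>
  [&& c != d, 0 < nth 0 (row j) c & 0 < nth 0 (row j.+1) d]) (iota 0 3)) (iota 0 3).
have ok_all : all ok (iota 0 31) by vm_compute.
have in_i : i %% 31 \in iota 0 31 by rewrite mem_iota ltn_pmod.
have := allP ok_all _ in_i; rewrite /ok => /hasP[c].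
rewrite mem_iota => lt_c /hasP[d]; rewrite mem_iota => lt_d /and3P[ne_cd row_c row_d].
apply: (@linkedI _ _ (Ordinal lt_c) (Ordinal lt_d)) => //=.
  by move: row_c; rewrite /row modn_mod.
by move: row_d; rewrite /row -[(i %% 31).+1]addn1 modnDml addn1.
Qed.

Lemma diam_slope16_ge c : diam_slope 16 c -> (31 / 216 <= c)%R.
Proof.
have periodic i : layer31 (i + 31) = layer31 i by rewrite /layer31 modnDr.
move=> /(slope_ge_periodic _ dominated_layer31 linked_layer31 periodic).
have -> : \sum_(0 <= i < 31) total (layer31 i) = 216.
  transitivity (\sum_(r <- cycle31) sumn r).
    rewrite (big_nth [::]); apply: eq_big_nat => i /andP[_ lt_i].
    by rewrite total_layer31 modn_small.
  by rewrite -(big_map sumn xpredT id) -sumnE.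
by move=> /(_ isT); rewrite ler_pdivrMr.
Qed.

(** * Minimum degree 8 *)

Lemma all_nth_default (T : Type) (x0 : T) (P : pred T) (s : seq T) n :
  P x0 -> all P s -> P (nth x0 s n).
Proof.
by move=> P0 /all_nthP Ps; have [/Ps//|ge_n] := ltnP n (size s); rewrite nth_default.
Qed.

(* A solution of the inequalities [step_ok], computed by relaxation over the
   pairs of layers with at most 8 vertices. Row indices are clipped to sizes
   1..7, first needs 1..7 and second needs 1..5. *)
Definition potential_table : seq (seq (seq nat)) :=
  [:: [:: [:: 5; 10; 10; 10; 10]; [:: 7; 10; 10; 10; 10]; [:: 8; 10; 10; 10; 10];
          [:: 8; 10; 10; 10; 10]; [:: 9; 10; 10; 10; 10]; [:: 10; 10; 10; 10; 10];
          [:: 10; 10; 10; 10; 10]];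
      [:: [:: 5; 6; 7; 8; 9]; [:: 6; 6; 7; 8; 9]; [:: 7; 7; 7; 8; 9];
          [:: 8; 8; 8; 8; 9]; [:: 8; 9; 9; 9; 9]; [:: 9; 9; 9; 9; 10];
          [:: 10; 10; 10; 10; 10]];
      [:: [:: 4; 5; 6; 7; 8]; [:: 5; 5; 6; 7; 8]; [:: 6; 6; 6; 7; 8];
          [:: 7; 7; 7; 7; 8]; [:: 7; 8; 8; 8; 8]; [:: 8; 8; 8; 8; 9];
          [:: 9; 9; 9; 9; 9]];
      [:: [:: 3; 5; 6; 7; 7]; [:: 4; 5; 6; 7; 7]; [:: 5; 5; 6; 7; 7];
          [:: 6; 6; 6; 7; 7]; [:: 6; 7; 7; 7; 7]; [:: 7; 7; 7; 7; 7];
          [:: 7; 7; 7; 7; 9]];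
      [:: [:: 3; 4; 5; 6; 7]; [:: 3; 4; 5; 6; 7]; [:: 4; 4; 5; 6; 7];
          [:: 4; 5; 5; 6; 7]; [:: 6; 6; 6; 6; 7]; [:: 7; 7; 7; 7; 7];
          [:: 7; 7; 7; 7; 10]];
      [:: [:: 2; 3; 4; 5; 6]; [:: 2; 3; 4; 5; 6]; [:: 3; 3; 4; 5; 6];
          [:: 4; 4; 4; 5; 6]; [:: 6; 6; 6; 6; 6]; [:: 7; 7; 7; 7; 10];
          [:: 7; 7; 7; 10; 10]];
      [:: [:: 0; 2; 3; 4; 10]; [:: 2; 2; 3; 4; 10]; [:: 3; 3; 3; 4; 10];
          [:: 4; 4; 4; 4; 10]; [:: 6; 6; 6; 6; 10]; [:: 7; 7; 7; 10; 10];
          [:: 7; 7; 10; 10; 10]]].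

(* [t] is the size of a layer; [d1 >= d2] are the two largest numbers of
   neighbours that a vertex of that layer still needs in the next one. *)
Definition potential (t d1 d2 : nat) : nat :=
  if 8 < t then 0 else
  nth 0 (nth [::] (nth [::] potential_table (minn t 7).-1) (minn d1 7).-1)
    (minn d2 5).-1.

(** This bounds the loss when the step inequalities are telescoped. *)
Lemma potential_le10 t d1 d2 : potential t d1 d2 <= 10.
Proof.
rewrite /potential; case: ifP => // _.
have all10 : all (all (all (leq^~ 10))) potential_table by vm_compute.
by apply: (@all_nth_default _ 0 (leq^~ 10)) => //;
  apply: all_nth_default => //; apply: all_nth_default.
Qed.

Lemma leq_potential t d1 d2 d1' d2' :
  d1 <= d1' -> d2 <= d2' -> potential t d1 d2 <= potential t d1' d2'.
Proof.
rewrite /potential => le1 le2; case: ifP => // _.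
(* Clipping the indices is monotone, so monotonicity of the table itself is enough. *)
have mono : all (fun t => all (fun i => all (fun i' => all (fun j => all (fun j' =>
    (i <= i') && (j <= j') ==>
    (nth 0 (nth [::] (nth [::] potential_table t) i) j <=
     nth 0 (nth [::] (nth [::] potential_table t) i') j'))
  (iota 0 5)) (iota 0 5)) (iota 0 7)) (iota 0 7)) (iota 0 7) by vm_compute.
have in_iota k n : 0 < n -> (minn k n).-1 \in iota 0 n by rewrite mem_iota; lia.
have := allP mono _ (in_iota t 7 isT) => /allP/(_ _ (in_iota d1 7 isT))
  /allP/(_ _ (in_iota d1' 7 isT))/allP/(_ _ (in_iota d2 5 isT))
  /allP/(_ _ (in_iota d2' 5 isT))/implyP; apply.
by lia.
Qed.

Definition max3 (a b c : nat) : nat := maxn a (maxn b c).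

(** The median, that is, the second largest of the three. *)
Definition mid3 (a b c : nat) : nat := maxn (minn a b) (maxn (minn a c) (minn b c)).

(** An absent colour needs nothing; truncated subtraction gives 0 once 8 neighbours are supplied. *)
Definition need (present supply : nat) : nat :=
  if present is 0 then 0 else 8 - supply.

(** Keeping only the size and the two largest needs makes the potential invariant under permutations
    of the colours. *)
Definition potential3 (a b c d e f : nat) : nat :=
  potential (a + b + c) (max3 d e f) (mid3 d e f).

Lemma leq_potential3 a b c d e f d' e' f' :
    d <= d' -> e <= e' -> f <= f' ->
  potential3 a b c d e f <= potential3 a b c d' e' f'.
Proof.
by move=> le_d le_e le_f; apply: leq_potential; rewrite /max3 /mid3; lia.
Qed.

(* By monotonicity the worst predecessor of a layer [(a, b, c)] followed by
   [(x, y, z)] supplies exactly what the latter does not. *)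
Definition step_ok (a b c x y z : nat) : bool :=
  7 + potential3 a b c (need a (8 - minn (y + z) (8 - (b + c))))
        (need b (8 - minn (x + z) (8 - (a + c))))
        (need c (8 - minn (x + y) (8 - (a + b))))
  <= 2 * (x + y + z) +
     potential3 x y z (need x (b + c + (y + z))) (need y (a + c + (x + z)))
       (need z (a + b + (x + y))).

Lemma step_ok_small a b c x y z :
  0 < a + b + c <= 8 -> 0 < x + y + z <= 8 -> step_ok a b c x y z.
Proof.
(* The nested ranges list exactly the triples of sum at most 8; the disjunctions skip the empty
   layer. *)
have all_ok : all (fun a => all (fun b => all (fun c => (a + b + c == 0) ||
   all (fun x => all (fun y => all (fun z => (x + y + z == 0) || step_ok a b c x y z)
     (iota 0 (9 - x - y))) (iota 0 (9 - x))) (iota 0 9))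
     (iota 0 (9 - a - b))) (iota 0 (9 - a))) (iota 0 9) by vm_compute.
move=> /andP[abc_gt0 le_abc] /andP[xyz_gt0 le_xyz].
have in_iota i n : i < n -> i \in iota 0 n by rewrite mem_iota.
have /(allP all_ok)/allP all_b : a \in iota 0 9 by apply: in_iota; lia.
have /all_b/allP all_c : b \in iota 0 (9 - a) by apply: in_iota; lia.
have /all_c : c \in iota 0 (9 - a - b) by apply: in_iota; lia.
rewrite (gtn_eqF abc_gt0) orFb => /allP all_x.
have /all_x/allP all_y : x \in iota 0 9 by apply: in_iota; lia.
have /all_y/allP all_z : y \in iota 0 (9 - x) by apply: in_iota; lia.
have /all_z : z \in iota 0 (9 - x - y) by apply: in_iota; lia.
by rewrite (gtn_eqF xyz_gt0).
Qed.

Definition color0 : 'I_3 := ord0.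
Definition color1 : 'I_3 := lift ord0 ord0.
Definition color2 : 'I_3 := lift ord0 (lift ord0 ord0).

Lemma total3 L : total L = L color0 + L color1 + L color2.
Proof. by rewrite /total !big_ord_recl big_ord0 addn0 addnA. Qed.

Lemma other3 L :
  [/\ other L color0 = L color1 + L color2, other L color1 = L color0 + L color2
    & other L color2 = L color0 + L color1].
Proof. by rewrite !other_total total3; split; lia. Qed.

Definition layer_potential (u v : 'I_3 -> nat) : nat :=
  let d c := need (v c) (other u c + other v c) in
  potential3 (v color0) (v color1) (v color2) (d color0) (d color1) (d color2).

Lemma layer_potential_le10 u v : layer_potential u v <= 10.
Proof. exact: potential_le10. Qed.

(** The amortised form of an average of 7/2 vertices per layer: a layer [w] with fewer is paid for
    by a rise of the potential. *)
Lemma layer_potential_step u v w :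
    0 < total v -> 0 < total w -> dominated 8 u v w ->
  7 + layer_potential u v <= 2 * total w + layer_potential v w.
Proof.
move=> v_gt0 w_gt0 /forallP dom.
(* Nine vertices give [2 * 9 >= 7 + 10], which covers any potential of the previous layer. *)
have [le_w|gt_w] := leqP (total w) 8; last first.
  by have := layer_potential_le10 u v; lia.
have [le_v|gt_v] := leqP (total v) 8; last first.
  have -> : layer_potential u v = 0.
    by rewrite /layer_potential /potential3 /potential -total3 gt_v.
  (* Here the potential at zero needs is enough: for sizes 1, 2 and 3 it is 5, 5 and 4, and from
     size 4 on [2 * total w] exceeds 7. *)
  have : potential (total w) 0 0 <= layer_potential v w.
    by rewrite total3; apply: leq_potential.
  by case: (total w) w_gt0 => [|[|[|[|k]]]] //=; rewrite /potential /=; lia.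
(* For a present colour the right-hand side is the smaller of [other w c], which bounds the need by
   domination, and [8 - other v c], which bounds it for any [u]. *)
have need_le c : need (v c) (other u c + other v c) <=
    need (v c) (8 - minn (other w c) (8 - other v c)).
  have := dom c; case: (v c) => //= k; lia.
have := need_le color0; have := need_le color1; have := need_le color2.
have := step_ok_small; rewrite total3 in v_gt0 le_v; rewrite total3 in w_gt0 le_w.
move=> /(_ (v color0) (v color1) (v color2) (w color0) (w color1) (w color2)).
rewrite v_gt0 le_v w_gt0 le_w => /(_ isT isT).
rewrite /layer_potential /= total3 /step_ok.
have [-> -> ->] := other3 v; have [-> -> ->] := other3 w.
move=> ok le2 le1 le0; apply: leq_trans ok; rewrite leq_add2l.
exact: leq_potential3.
Qed.

Lemma EPPT_8 : EPPT_3colorable 8.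
Proof.
(* The bound [7 * D <= 2 * order_of G + 17] below leaves the constant 17/7, which is less than 5. *)
exists 5%:R%R => G [conn degG /chromatic_number_le3P[f f_col]].
have [x [y ->]] := diam_attained conn.
set D := dist x y; pose w := dist_layer f x.
have w_gt0 i : i <= D -> 0 < total (w i).
  case: i => [|i] le_i; last first.
    by have [] := linked_total_gt0 (linked_dist_layer conn f_col le_i).
  by rewrite total_dist_layer card_gt0; apply/set0Pn; exists x; rewrite inE distxx.
(* The sum starts at layer 2, the third layer of the first triple. *)
have descend n : n < D ->
    7 * n + layer_potential (w 0) (w 1) <=
    2 * (\sum_(2 <= i < n.+2) total (w i)) + layer_potential (w n) (w n.+1).
  elim: n => [|n IH] lt_n; first by rewrite big_geq.
  have /IH : n < D by apply: ltnW.
  have := @layer_potential_step (w n) (w n.+1) (w n.+2)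
    (w_gt0 _ (ltnW lt_n)) (w_gt0 _ lt_n).
  have := dominated_dist_layer conn f_col x n; rewrite degG -/w => dom /(_ dom).
  by rewrite [X in _ -> _ -> _ <= 2 * X + _]big_nat_recr //=; lia.
(* Only [D.-1] steps are available, which costs 7; the final potential costs at most 10. *)
have bound : 7 * D <= 2 * order_of G + 17.
  have [->|D_gt0] := posnP D; first by [].
  have /descend : D.-1 < D by rewrite prednK.
  have := layer_potential_le10 (w D.-1) (w D.-1.+1).
  have := sum_dist_layer f x D.+1; rewrite -/w /order_of prednK //.
  by rewrite big_ltn // [X in _ + X <= _]big_ltn //; lia.
have : (7 * D%:R <= 2 * (order_of G)%:R + 17 :> rat)%R.
  by rewrite -!natrM -natrD ler_nat.
lra.
Qed.

Local Open Scope ring_scope.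

Theorem mainTheorem8 :
  (exists f : rat, [/\ is_fprime 16 f, 31 / 216 <= f & (1 / 7 : rat) < 31 / 216])
  /\ [/\ EPPT_3colorable 8,
         ~ EPPT_3colorable 16 &
         forall delta : nat, (0 < delta)%N -> (8 %| delta)%N ->
           ~ EPPT_3colorable delta -> (16 <= delta)%N].
Proof.
have lt_17 : (1 / 7 : rat) < 31 / 216 by lra.
split; last split.
- have [f [slope_f min_f]] := @fprime_exists 16 isT.
  by exists f; split; [split | apply: diam_slope16_ge | apply: lt_17].
- exact: EPPT_8.
(* For [delta = 16] the coefficient [16 / 7 / delta] is 1/7. *)
- case=> C bound; have : diam_slope 16 (1 / 7).
    exists C => G /bound; congr (_ <= _ + C).
    by rewrite mulrCA; field.
  by move=> /diam_slope16_ge; rewrite leNgt lt_17.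
move=> delta delta_gt0 dvd_delta not_EPPT; rewrite leqNgt; apply/negP=> lt_delta.
have delta8 : delta = 8%N by lia.
by apply: not_EPPT; rewrite delta8; apply: EPPT_8.
Qed.
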